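(* Let $r,k\in\mathbb Z$, $0\le k\le r$, and suppose that $U\in Y_r$ solves $\mathbf{VTD}^r_k\big(\mathcal If\big)$, with initial value $u_0$, where $\mathcal I\in\{\mathrm{Id},\mathcal I^r_k\}$. Then $U^{(j)}\in Y_{r-j}$, $0\le j\le\lfloor\frac k2\rfloor$, solves $\mathbf{VTD}^{r-j}_{k-2j}\big((\mathcal If)^{(j)}\big)$ if $u^{(j)}(t_0)$ is used as initial condition (i.e. as the value at $t_0^-$).
   Context: Problem: $M u'(t)=f(t)-Au(t)$, $u(t_0)=u_0\in\mathbb R^d$, on $I=(t_0,t_0+T]$, $T>0$, with time-independent $M,A\in\mathbb R^{d\times d}$, $M$ regular, and $f:\overline I\to\mathbb R^d$ sufficiently smooth (all derivatives of $f$ that occur exist and are continuous). The values $u^{(j)}(t_0)$ are defined recursively by $u^{(0)}(t_0)=u_0$ and $M u^{(j)}(t_0)=f^{(j-1)}(t_0)-Au^{(j-1)}(t_0)$, $j\ge1$. Notation: mesh $t_0<t_1<\dots<t_N=t_0+T$, $I_n=(t_{n-1},t_n]$. $(\cdot,\cdot)$ is the Euclidean inner product on $\mathbb R^d$. $P_s(J,\mathbb R^q)$ is the space of $\mathbb R^q$-valued polynomials on $J$ of degree $\le s$. $Y_s$ is the space of functions $\varphi\in L^2(I,\mathbb R^d)$ with $\varphi|_{I_n}\in P_s(I_n,\mathbb R^d)$ for all $n=1,\dots,N$. $v(t_n^\pm)$ are one-sided limits, $[v]_n=v(t_n^+)-v(t_n^-)$; derivatives of piecewise smooth functions are taken interval-wise.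 $\delta_{i,j}$ is the Kronecker delta. Interpolation: for integers $0\le k\le r$ let $\widehat{\mathcal I}^r_k:C^{\lfloor k/2\rfloor}([-1,1])\to P_r([-1,1])$ be the Hermite interpolation operator preserving derivatives of orders $0,\dots,\lfloor\frac{k-1}{2}\rfloor$ at $-1$ (none if $k=0$), derivatives of orders $0,\dots,\lfloor\frac k2\rfloor$ at $+1$, and the function values at the zeros in $(-1,1)$ of the $(r-k)$th Jacobi polynomial with respect to the weight $(1+\hat t)^{\lfloor\frac{k-1}{2}\rfloor+1}(1-\hat t)^{\lfloor\frac k2\rfloor+1}$. $\mathcal I^r_k$ denotes its affine transformation to $I_n$, applied componentwise on each $I_n$. Method: for integers $0\le m\le s$, an interval-wise sufficiently smooth function $g$ and an initial value $v_0\in\mathbb R^d$, a function $V\in Y_s$ with $V(t_0^-)=v_0$ solves $\mathbf{VTD}^s_m(g)$ (exact integration) with initial value $v_0$ if for every $n=1,\dots,N$: (1) if $m\ge1$: $V(t_{n-1}^+)=V(t_{n-1}^-)$; (2) if $m\ge2$: $M V^{(i+1)}(t_n^-)=g^{(i)}(t_n^-)-AV^{(i)}(t_n^-)$ for $i=0,\dots,\lfloor\frac m2\rfloor-1$; (3) if $m\ge3$: $M V^{(i+1)}(t_{n-1}^+)=g^{(i)}(t_{n-1}^+)-AV^{(i)}(t_{n-1}^+)$ for $i=0,\dots,\lfloor\frac{m-1}2\rfloor-1$; (4) $\int_{I_n}(MV'+AV,\varphi)\,\mathrm dt+\delta_{0,m}\big(M[V]_{n-1},\varphi(t_{n-1}^+)\big)=\int_{I_n}(g,\varphi)\,\mathrm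 dt$ for all $\varphi\in P_{s-m}(I_n,\mathbb R^d)$. *)

(* Defs.v *)
From HB Require Import structures.
From mathcomp Require Import all_boot all_order all_algebra.
From mathcomp Require Import all_classical all_reals all_analysis.

Set Implicit Arguments.
Unset Strict Implicit.
Unset Printing Implicit Defensive.

Import Order.TTheory GRing.Theory Num.Theory.
Import numFieldNormedType.Exports.

Local Open Scope classical_set_scope.
Local Open Scope ring_scope.

(* Functions on an interval are modelled by total functions on R; every notion
   below only looks at the values on the interval in question. *)

Section Calculus.
Variables (R : realType) (W : normedModType R).
Implicit Types (J : set R) (g : R -> W).

(* Derivative of the restriction of g to J: one-sided at end points of J that
   belong to J. *)
Definition diff_quot g (x y : R) : W := (y - x)^-1 *: (g y - g x).

Definition derive_on J g (x : R) : W := lim (diff_quot g x @ within J x^').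

Definition deriven_on J (l : nat) g : R -> W := iter l (derive_on J) g.

(* g is in C^p(J) *)
Definition C_on J (p : nat) g : Prop :=
  (forall l, (l < p)%N -> forall x, J x ->
     cvg (diff_quot (deriven_on J l g) x @ within J x^')) /\
  (forall l, (l <= p)%N -> {within J, continuous (deriven_on J l g)}).

End Calculus.

Section Mesh.
Variables (R : realType) (N : nat) (t : nat -> R).

Definition is_mesh (t0 T : R) : Prop :=
  [/\ t 0%N = t0, t N = t0 + T & forall n, (n < N)%N -> t n < t n.+1].

(* 0-based: for n < N, [cell n] is the interval I_(n+1) = (t_n, t_(n+1)]. *)
Definition cell (n : nat) : set R := [set` `]t n, t n.+1]].

Definition piecewise (W : nmodType) (F : nat -> R -> W) (x : R) : W :=
  \sum_(n < N) (if x \in cell n then F n x else 0).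

(* Interval-wise derivatives (left derivatives at the right end points) *)
Definition pw_derive (W : normedModType R) (g : R -> W) : R -> W :=
  piecewise (fun n => derive_on (cell n) g).

Definition pw_deriven (W : normedModType R) (j : nat) (g : R -> W) : R -> W :=
  iter j (@pw_derive W) g.

End Mesh.

Section Polynomials.
Variables (R : realType) (d : nat).

(* phi|_J belongs to P_s(J, R^d) *)
Definition poly_on (J : set R) (s : nat) (phi : R -> 'cV[R]_d) : Prop :=
  exists p : 'I_d -> {poly R}, (forall i, (size (p i) <= s.+1)%N) /\
    forall x, J x -> phi x = \col_i (p i).[x].

(* Membership in Y_s; square integrability is automatic for functions that are
   polynomial on each of the finitely many bounded cells. *)
Definition Yspace (N : nat) (t : nat -> R) (s : nat) (V : R -> 'cV[R]_d) : Prop :=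
  forall n, (n < N)%N -> poly_on (cell t n) s V.

Definition dotv (x y : 'cV[R]_d) : R := \sum_i x i 0 * y i 0.

End Polynomials.

Section Interpolation.
Variable R : realType.

(* P is the monic polynomial of degree n orthogonal, for the weight
   (1 + x)^a (1 - x)^b on [-1, 1], to all polynomials of degree < n. *)
Definition is_jacobi (a b n : nat) (P : {poly R}) : Prop :=
  [/\ P \is monic, size P = n.+1 &
    forall q : {poly R}, (size q <= n)%N ->
      \int[lebesgue_measure]_(x in [set` `[(-1 : R), 1]])
        ((1 + x) ^+ a * (1 - x) ^+ b * (P.[x] * q.[x])) = 0].

(* The Jacobi polynomial up to normalization; only its zeros are used. *)
Definition jacobi (a b n : nat) : {poly R} := xget 1 [set P | is_jacobi a b n P].

(* Conditions defining the Hermite interpolant of degree <= r on [-1, 1].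
   For every k >= 0, floor((k-1)/2) + 1 = k.+1./2, so the orders
   0, ..., floor((k-1)/2) are the l < k.+1./2 (none if k = 0). *)
Definition is_hermite (r k : nat) (g : R -> R) (p : {poly R}) : Prop :=
  let D l := deriven_on [set` `[(-1 : R), 1]] l g in
  [/\ (size p <= r.+1)%N,
      forall l, (l < k.+1./2)%N -> p^`(l).[-1] = D l (-1),
      forall l, (l <= k./2)%N -> p^`(l).[1] = D l 1 &
      forall x, -1 < x < 1 -> root (jacobi k.+1./2 k./2.+1 (r - k)) x ->
        p.[x] = g x].

Definition hermite (r k : nat) (g : R -> R) : {poly R} :=
  xget 0 [set p | is_hermite r k g p].

(* Affine map [-1, 1] -> [a, b] and its inverse *)
Definition from_ref (a b x : R) : R := (a + b) / 2 + (b - a) / 2 * x.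
Definition to_ref (a b y : R) : R := (2 * y - (a + b)) / (b - a).

Definition interp (d N : nat) (t : nat -> R) (r k : nat) (g : R -> 'cV[R]_d) :
    R -> 'cV[R]_d :=
  piecewise N t (fun n x =>
    \col_i (hermite r k (fun y => g (from_ref (t n) (t n.+1) y) i 0)).[to_ref (t n) (t n.+1) x]).

End Interpolation.

Section VTD.
Variables (R : realType) (d : nat) (M A : 'M[R]_d) (N : nat) (t : nat -> R).

(* The value V(t_n^-), where V(t_0^-) is the prescribed initial value v0. *)
Definition left_value (v0 : 'cV[R]_d) (V : R -> 'cV[R]_d) (n : nat) : 'cV[R]_d :=
  if n is 0%N then v0 else lim (V @ (t n)^'-).

(* V solves VTD^s_m(g) with initial value v0.  The upper bounds i < m./2 and
   i < m.-1./2 leave no condition when m < 2, resp. m < 3. *)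
Definition VTD (s m : nat) (g : R -> 'cV[R]_d) (v0 : 'cV[R]_d)
    (V : R -> 'cV[R]_d) : Prop :=
  let D i := @pw_deriven R N t 'cV[R]_d i in
  Yspace N t s V /\
  forall n, (n < N)%N ->
  [/\ (1 <= m)%N -> lim (V @ (t n)^'+) = left_value v0 V n,
      forall i, (i < m./2)%N ->
        M *m lim (D i.+1 V @ (t n.+1)^'-) =
          lim (D i g @ (t n.+1)^'-) - A *m lim (D i V @ (t n.+1)^'-),
      forall i, (i < m.-1./2)%N ->
        M *m lim (D i.+1 V @ (t n)^'+) =
          lim (D i g @ (t n)^'+) - A *m lim (D i V @ (t n)^'+) &
      forall phi : R -> 'cV[R]_d, poly_on (cell t n) (s - m) phi ->
        \int[lebesgue_measure]_(x in cell t n)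
            dotv (M *m D 1%N V x + A *m V x) (phi x)
          + (m == 0%N)%:R *
            dotv (M *m (lim (V @ (t n)^'+) - left_value v0 V n)) (lim (phi @ (t n)^'+))
        = \int[lebesgue_measure]_(x in cell t n) dotv (g x) (phi x)].

(* u^(j)(t0), with M u^(j)(t0) = f^(j-1)(t0) - A u^(j-1)(t0), M being regular *)
Fixpoint uderiv (f : R -> 'cV[R]_d) (u0 : 'cV[R]_d) (t0 T : R) (j : nat) : 'cV[R]_d :=
  if j is j'.+1 then
    invmx M *m (deriven_on [set` `[t0, t0 + T]] j' f t0 - A *m uderiv f u0 t0 T j')
  else u0.

End VTD.

(* Main.v *)
Require Import Defs.
From mathcomp Require Import all_boot all_order all_algebra.
From mathcomp Require Import all_classical all_reals all_analysis.
From mathcomp Require Import ring lra zify.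
Import Order.TTheory GRing.Theory Num.Theory.
Import numFieldNormedType.Exports.
Local Open Scope classical_set_scope.
Local Open Scope ring_scope.

(** The derivative of a solution solves the differentiated problem because each
    differentiation lowers the degree by one and uses up two of the [m] pointwise
    conditions of a cell.

    On every cell the solution is a polynomial vector, and the right-hand side
    and its derivatives extend continuously to the closed cell.  Hence the
    problem is equivalent to one about polynomials and values at end points
    ([VTD_cellVTD]), and it suffices to pass from [(s, m)] with right-hand side
    [g] to [(s - 1, m - 2)] with right-hand side [g'] ([cellVTD_deriv]).  The
    collocation conditions for [U'] are those for [U], one order higher.  When
    [m >= 3], [M U' = g - A U] holds on both sides of a node, so the continuity of
    [U] and [g] there gives that of [U'], [M] being regular.  The variational
    equation for [U'] tested with [phi] is, after integration by parts, the
    equation for [U] tested with [phi'] plus end point values of the residual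
    [M U' + A U - g].  At the right end this residual is zero by collocation.  At the left end it
    is zero when [m >= 3], and when [m = 2] it is [M] times the jump of [U'],
    which is the jump term of the new equation, with [m - 2 = 0].

    The argument needs the derivatives of the right-hand side of orders below
    [k./2] to agree with those of [f] at the ends of every cell, including
    [t0], where the initial values are defined through [f]
    ([right_hand_side_jets]).  This is clear for [f] itself.  For the
    interpolant it is part of the Hermite conditions, provided that an
    interpolant exists; there are at most [r + 1] conditions, and Newton's
    construction yields a polynomial of degree at most [r] meeting them
    ([hermiteP]). *)

Set Implicit Arguments.
Unset Strict Implicit.
Unset Printing Implicit Defensive.

(** * One-sided derivatives and jets on intervals *)
Section OneSidedDerivatives.
Variables (R : realType) (W : normedModType R).
Implicit Types (g : R -> W) (a b x : R) (J K : set R).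

Definition deriv_on J g g' : Prop :=
  forall x, J x -> diff_quot g x y @[y --> within J x^'] --> (g' x : W).

(** Transports difference quotients along changes of variable: [rho] must avoid
    the value [rho x] away from [x], since both neighbourhoods are punctured. *)
Lemma cvg_within_dnbhs (rho : R -> R) J K x :
  {for x, continuous rho} -> (forall y, y != x -> rho y != rho x) ->
  (forall y, J y -> K (rho y)) ->
  rho y @[y --> within J x^'] --> within K (rho x)^'.
Proof.
move=> crho inj JK S KS.
have nS : \forall z \near rho x, z != rho x -> K z -> S z by exact: KS.
have : \forall y \near x, y != x -> J y -> S (rho y).
  have nS' : \forall y \near x, rho y != rho x -> K (rho y) -> S (rho y).
    exact: crho _ nS.
  apply: filterS nS' => y /= yS yx Jy.
  by apply: yS; [exact: inj | exact: JK].
by [].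
Qed.

Lemma is_derive1P g x (l : W) :
  is_derive x 1 g l <-> diff_quot g x y @[y --> x^'] --> l.
Proof.
have shiftP (c z : R) : z + c @[z --> z^'] --> (z + c)^'.
  have withinTE y : within setT y^' = y^' :> set_system R.
    apply/predeqP => S; rewrite /within /= /prop_near1.
    split=> h; apply: filterS h => u //; exact.
  have := @cvg_within_dnbhs (+%R^~ c) setT setT z.
  rewrite !withinTE; apply => //; first exact: (cvgD cvg_id (cvg_cst _)).
  by move=> y; apply: contra_neq => /addIr.
have qE y : (y - x)^-1 *: ((g \o shift x) ((y - x) *: 1) - g x) = diff_quot g x y.
  by rewrite /diff_quot /= [_ *: 1]mulr1 subrK.
split=> [[dg <-]|dg].
  have := @cvg_comp _ _ _ (+%R^~ (- x)) _ _ _ _ (shiftP (- x) x).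
  rewrite subrr => /(_ _ _ _ dg); apply: cvg_trans; apply: near_eq_cvg.
  by near=> y; rewrite /= -qE.
have dg' : h^-1 *: ((g \o shift x) (h *: 1) - g x) @[h --> 0^'] --> l.
  have := @cvg_comp _ _ _ (+%R^~ x) _ _ _ _ (shiftP x 0).
  rewrite add0r => /(_ _ _ _ dg); apply: cvg_trans; apply: near_eq_cvg.
  by near=> h; rewrite /= -qE /= addrK.
by split; [apply/cvg_ex; exists l | exact: (cvg_lim (@norm_hausdorff _ _) dg')].
Unshelve. all: by end_near. Qed.

Lemma deriv_on_is_derive a b g g' x :
  deriv_on `[a, b] g g' -> a < x < b -> is_derive x 1 g (g' x).
Proof.
move=> dg /andP[ax xb]; apply/is_derive1P.
apply: cvg_trans (dg x _); last by rewrite /= in_itv /= !ltW.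
have xab : x \in `]a, b[ by rewrite in_itv /= ax.
apply: cvg_app => S; rewrite /within /= => SJ.
have nJ : \forall y \near x^', y \in `]a, b[.
  exact/nbhs_dnbhs/near_in_itvoo.
apply: filterS2 nJ SJ => y /= yab; apply; exact: subset_itv_oo_cc.
Qed.

(** Makes the limit that defines [derive_on] unique at every point of an
    interval, end points included: an interval accumulates at each of its
    points, from the right or from the left. *)
Lemma within_dnbhs_proper a b J x :
  a < b -> `]a, b[ `<=` J -> a <= x <= b -> ProperFilter (within J x^').
Proof.
move=> ab abJ /andP[ax xb]; split; last exact: within_filter.
have [xb'|bx] := ltP x b.
  move=> /= w0.
  have w0x : \forall y \near x, y != x -> J y -> False by exact: w0.
  have : \forall y \near x^'+, False.
    have : \forall y \near x^'+, J y -> False.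
      rewrite near_withinE; apply: filterS w0x => y yJ xy Jy.
      by apply: (yJ _ Jy); rewrite gt_eqF.
    apply: filter_app; near=> y; apply; apply: abJ.
    rewrite /= in_itv /=; apply/andP; split; last by near: y; exact: nbhs_right_lt.
    by rewrite (le_lt_trans ax)//; near: y; exact: nbhs_right_gt.
  exact: filter_not_empty.
have {xb bx}-> : x = b by apply/eqP; rewrite eq_le xb.
move=> /= w0.
have w0x : \forall y \near b, y != b -> J y -> False by exact: w0.
have : \forall y \near b^'-, False.
  have : \forall y \near b^'-, J y -> False.
    rewrite near_withinE; apply: filterS w0x => y yJ xy Jy.
    by apply: (yJ _ Jy); rewrite lt_eqF.
  apply: filter_app; near=> y; apply; apply: abJ.
  rewrite /= in_itv /=; apply/andP; split; first by near: y; exact: nbhs_left_gt.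
  by near: y; exact: nbhs_left_lt.
exact: filter_not_empty.
Unshelve. all: by end_near. Qed.

(** [derive_on J g x] sees [g] on [J] only, and shrinking the domain keeps a
    convergent difference quotient convergent.  Hence a one-sided derivative on
    a half-open cell may be read off from any representative [h] that is
    differentiable on a larger set [K], such as the closed cell. *)
Lemma deriv_onE a b J K g h h' x :
  a < b -> `]a, b[ `<=` J -> a <= x <= b -> J x -> J `<=` K ->
  {in J, g =1 h} -> deriv_on K h h' -> derive_on J g x = h' x.
Proof.
move=> ab abJ xab Jx JK gh dh.
have pf := within_dnbhs_proper ab abJ xab.
apply: cvg_lim => //.
apply: cvg_trans (cvg_trans _ (dh x (JK _ Jx))); last first.
  exact: cvg_app (within_subset _ JK).
apply: near_eq_cvg; rewrite near_withinE; near=> y => Jy.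
by rewrite /diff_quot !gh ?inE.
Unshelve. all: by end_near. Qed.

(** A function and its first [p] derivatives on a closed interval, kept as a
    sequence of functions: polynomials, the derivatives of [f] on the whole time
    interval and the interpolant of [f] are then treated alike, with values at
    both end points of a cell although the cell contains only one of them. *)
Definition jet a b p (G : nat -> R -> W) : Prop :=
  (forall l, (l < p)%N -> deriv_on `[a, b] (G l) (G l.+1)) /\
  (forall l, (l <= p)%N -> {within `[a, b], continuous (G l)}).

Lemma deriv_onW J K g g' : J `<=` K -> deriv_on K g g' -> deriv_on J g g'.
Proof.
move=> JK dg x Jx; apply: cvg_trans (dg x (JK _ Jx)).
exact: cvg_app (within_subset _ JK).
Qed.

Lemma jet_sub a b c d p G :
  a <= c -> d <= b -> jet a b p G -> jet c d p G.
Proof.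
move=> ac db [dG cG]; have cdab : `[c, d] `<=` `[a, b].
  by apply: subset_itv; rewrite bnd_simp.
split=> l lp; first exact: deriv_onW (dG l lp).
exact: continuous_subspaceW (cG l lp).
Qed.

Lemma jet_shift a b p j G :
  (j <= p)%N -> jet a b p G -> jet a b (p - j) (fun l => G (l + j)%N).
Proof.
by move=> jp [dG cG]; split=> l lp; [apply: (dG (l + j)%N) | apply: cG]; lia.
Qed.

Lemma C_on_jet a b p g :
  C_on `[a, b] p g -> jet a b p (fun l => deriven_on `[a, b] l g).
Proof. by move=> [dg cg]; split=> // l lp x Jx; exact: dg. Qed.

Lemma jet_lim_right a b p G l V : a < b -> jet a b p G -> (l <= p)%N ->
  {in [set` `]a, b]], V =1 G l} -> lim (V x @[x --> a^'+]) = G l a.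
Proof.
move=> ab [_ /(_ l) cG] lp VG; apply: cvg_lim => //.
have [_ + _] := (continuous_within_itvP _ ab).1 (cG lp).
apply: cvg_trans; apply: near_eq_cvg; near=> x; rewrite VG// inE /= in_itv /=.
by apply/andP; split=> //; near: x; exact: nbhs_right_le.
Unshelve. all: by end_near. Qed.

Lemma jet_lim_left a b p G l V : a < b -> jet a b p G -> (l <= p)%N ->
  {in [set` `]a, b]], V =1 G l} -> lim (V x @[x --> b^'-]) = G l b.
Proof.
move=> ab [_ /(_ l) cG] lp VG; apply: cvg_lim => //.
have [_ _] := (continuous_within_itvP _ ab).1 (cG lp).
apply: cvg_trans; apply: near_eq_cvg; near=> x; rewrite VG// inE /= in_itv /=.
by apply/andP; split => //; near: x; exact: nbhs_left_gt.
Unshelve. all: by end_near. Qed.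

End OneSidedDerivatives.

(** * Polynomial vectors and integration by parts *)
Section PolynomialVectors.
Variables (R : realType) (d : nat).
Implicit Types (p q : 'I_d -> {poly R}) (a b : R).

Definition pvec p (l : nat) (x : R) : 'cV[R]_d := \col_i ((p i)^`(l)).[x].

Lemma pvec_is_derive p l (x : R) : is_derive x 1 (pvec p l) (pvec p l.+1 x).
Proof.
have dp : derivable (pvec p l) x 1.
  apply/derivable_mxP => i j.
  rewrite (_ : (fun x => _) = horner (p i)^`(l)); first exact: derivable_horner.
  by apply/funext => y; rewrite mxE.
split=> //; rewrite derive_mx//; apply/matrixP => i j; rewrite !mxE.
rewrite (_ : (fun x => _) = horner (p i)^`(l)); last first.
  by apply/funext => y; rewrite mxE.
by rewrite derivnS derive_val.
Qed.

Lemma pvec_jet p a b k : jet a b k (pvec p).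
Proof.
split=> l _.
  move=> x _; have /is_derive1P := pvec_is_derive p l x.
  by apply: cvg_trans; apply: cvg_app; exact: cvg_within.
apply: continuous_subspaceT => x.
apply: differentiable_continuous; apply/derivable1_diffP.
by have [] := pvec_is_derive p l x.
Qed.

Lemma pvec_deriv p l : pvec (fun i => (p i)^`()) l = pvec p l.+1.
Proof. by apply/funext => x; apply/colP => i; rewrite !mxE /derivn -iterSr. Qed.

Lemma size_derivn (p : {poly R}) j : (size p^`(j) <= size p - j)%N.
Proof.
elim: j => [|j IHj]; rewrite ?subn0// derivnS.
by rewrite (leq_trans (size_poly _ _))//; lia.
Qed.

End PolynomialVectors.

Section VectorIntegration.
Variables (R : realType) (d : nat).
Implicit Types (p q : 'I_d -> {poly R}) (a b : R) (w : R -> 'cV[R]_d).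

Lemma continuous_dotv (J : set R) w w' :
  {within J, continuous w} -> {within J, continuous w'} ->
  {within J, continuous (fun x => dotv (w x) (w' x))}.
Proof.
move=> cw cw'; apply: (@continuous_big _ _ _ _ _ add_continuous) => i _ x.
apply: cvgM.
  exact: (continuous_comp (cw x) (@coord_continuous _ _ _ _ _ _)).
exact: (continuous_comp (cw' x) (@coord_continuous _ _ _ _ _ _)).
Qed.

Lemma integrable_within a b (g : R -> R) :
  {within `[a, b], continuous g} ->
  (@lebesgue_measure R).-integrable `[a, b] (EFin \o g).
Proof. by apply: continuous_compact_integrable; exact: segment_compact. Qed.

(** The left end point of a cell is a null set, so integrals over the half-open
    cell may be computed from representatives on the closed one, where
    integration by parts applies. *)
Lemma integral_oc_cc a b (g h : R -> R) : a < b ->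
  {within `[a, b], continuous h} -> {in [set` `]a, b]], g =1 h} ->
  \int[lebesgue_measure]_(x in `]a, b]) g x =
  \int[lebesgue_measure]_(x in `[a, b]) h x.
Proof.
move=> ab ch gh.
transitivity (\int[lebesgue_measure]_(x in `]a, b]) h x).
  exact: eq_Rintegral.
apply: Rintegral_itv_obnd_cbnd.
by apply: integrableS (integrable_within ch) => //; exact: subset_itv_oc_cc.
Qed.

Lemma is_derive_dotv w w' (x : R) (v v' : 'cV[R]_d) :
  is_derive x 1 w v -> is_derive x 1 w' v' ->
  is_derive x 1 (fun y => dotv (w y) (w' y)) (dotv v (w' x) + dotv (w x) v').
Proof.
have coord (u : R -> 'cV[R]_d) z i : is_derive x 1 u z ->
    is_derive x 1 (fun y => u y i 0) (z i 0).
  move=> [du <-]; split; first exact: ((derivable_mxP _ _ _).1 du).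
  by rewrite derive_mx// mxE.
move=> dw dw'.
have := is_derive_sum (fun i => is_deriveM (coord _ _ i dw) (coord _ _ i dw')).
rewrite (_ : \sum_(i < d) _ = fun y => dotv (w y) (w' y)); last first.
  by apply/funext => y; rewrite fct_sumE.
move=> dS; apply: is_derive_eq.
rewrite /dotv -big_split /=; apply: eq_bigr => i _.
by rewrite addrC; congr (_ + _); rewrite [LHS]mulrC.
Qed.

Lemma dotv_by_parts a b (G : nat -> R -> 'cV[R]_d) q : a < b ->
  jet a b 1 G ->
  \int[lebesgue_measure]_(x in `[a, b]) dotv (G 1%N x) (pvec q 0 x) =
  dotv (G 0%N b) (pvec q 0 b) - dotv (G 0%N a) (pvec q 0 a) -
  \int[lebesgue_measure]_(x in `[a, b]) dotv (G 0%N x) (pvec q 1 x).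
Proof.
move=> ab [dG cG]; have [_ cq] := pvec_jet q a b 1.
have c10 := continuous_dotv (cG 1%N isT) (cq 0%N isT).
have c01 := continuous_dotv (cG 0%N isT) (cq 1%N isT).
have c00 := continuous_dotv (cG 0%N isT) (cq 0%N isT).
have [i10 i01] := (integrable_within c10, integrable_within c01).
apply/eqP; rewrite -subr_eq opprK; apply/eqP.
rewrite -RintegralD//=.
have dB x : x \in `]a, b[ -> is_derive x 1
    (fun y => dotv (G 0%N y) (pvec q 0 y))
    (dotv (G 1%N x) (pvec q 0 x) + dotv (G 0%N x) (pvec q 1 x)).
  rewrite in_itv /= => xab; apply: is_derive_dotv (pvec_is_derive _ _ _).
  exact: (deriv_on_is_derive (dG 0%N isT) xab).
have [_ cGa cGb] := (continuous_within_itvP _ ab).1 c00.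
rewrite /Rintegral
  (continuous_FTC2 ab _ (F := fun y => dotv (G 0%N y) (pvec q 0 y))) //.
- by move=> x; apply: cvgD; [exact: c10 | exact: c01].
- by split=> // x /dB[].
- by move=> x /dB[]; rewrite derive1E.
Qed.

End VectorIntegration.

(** * Interval-wise derivatives on the cells of a mesh *)
Section MeshCells.
Variables (R : realType) (N : nat) (t : nat -> R).
Hypothesis tS : forall n, (n < N)%N -> t n < t n.+1.

Lemma mesh_le m n : (m <= n <= N)%N -> t m <= t n.
Proof.
elim: n => [|n IHn]; first by rewrite leqn0 => /andP[/eqP ->].
rewrite leq_eqVlt => /andP[/predU1P[->//|]]; rewrite ltnS => mn nN.
by rewrite (le_trans (IHn _)) ?mn ?(ltnW nN)// ltW// tS.
Qed.

Lemma piecewise_cell (W : nmodType) (F : nat -> R -> W) n x :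
  (n < N)%N -> x \in cell t n -> piecewise N t F x = F n x.
Proof.
move=> nN xn; rewrite /piecewise (bigD1 (Ordinal nN))//= xn big1 ?addr0//.
move=> m mn; case: ifPn => // xm; exfalso; move: xm xn.
rewrite !inE /cell /= !in_itv /= => /andP[tmx xm] /andP[tnx xn].
have [mn'|nm|mn'] := ltngtP m n; last by rewrite -val_eqE /= mn' eqxx in mn.
- by have := @mesh_le m.+1 n; rewrite mn' ltnW// => /(_ isT); lra.
- have := @mesh_le n.+1 m; rewrite nm (ltnW (ltn_ord m)) => /(_ isT); lra.
Qed.

Lemma pw_deriven_jet (W : normedModType R) (V : R -> W) G n p :
  (n < N)%N -> jet (t n) (t n.+1) p G -> {in cell t n, V =1 G 0%N} ->
  forall l, (l <= p)%N -> {in cell t n, pw_deriven N t l V =1 G l}.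
Proof.
move=> nN [dG _] VG; elim=> [//|l IHl] lp x xn.
rewrite [LHS](piecewise_cell _ nN xn); move: (xn); rewrite inE => xn'.
have tn := tS nN.
apply: (deriv_onE tn _ _ xn' _ (IHl (ltnW lp)) (dG l lp)).
- exact: subset_itv_oo_oc.
- by move: xn'; rewrite /cell /= in_itv /= => /andP[/ltW -> ->].
- exact: subset_itv_oc_cc.
Qed.

End MeshCells.

(** * The cell-wise problem and its derivative *)
Section CellwiseProblem.
Variables (R : realType) (d : nat) (M A : 'M[R]_d) (N : nat) (t : nat -> R).
Hypothesis tS : forall n, (n < N)%N -> t n < t n.+1.
Implicit Types (P : nat -> 'I_d -> {poly R}) (G : nat -> nat -> R -> 'cV[R]_d).

(** [M p' + A p] as a polynomial vector, so that it can be differentiated and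
    integrated by parts like the pieces of the solution. *)
Definition lhs_poly (p : 'I_d -> {poly R}) (i : 'I_d) : {poly R} :=
  \sum_j (M i j *: (p j)^`() + A i j *: p j).

Lemma lhs_polyE p l x :
  pvec (lhs_poly p) l x = M *m pvec p l.+1 x + A *m pvec p l x.
Proof.
apply/colP => i; rewrite !mxE /lhs_poly linear_sum horner_sum -big_split /=.
apply: eq_bigr => j _.
by rewrite linearD /= !linearZ /= hornerD !hornerZ !mxE /derivn -iterSr.
Qed.

Definition cell_left (v0 : 'cV[R]_d) P (n : nat) : 'cV[R]_d :=
  if n is n'.+1 then pvec (P n') 0 (t n) else v0.

(** The discrete problem for the polynomial pieces [P n] of the solution and the
    jets [G n] of the right-hand side on the closed cells: one-sided limits are
    values, interval-wise derivatives are [l]-th components, and test functions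
    are polynomials. *)
Definition cellVTD (s m : nat) G v0 P : Prop :=
  forall n, (n < N)%N ->
  [/\ (1 <= m)%N -> pvec (P n) 0 (t n) = cell_left v0 P n,
      forall i, (i < m./2)%N ->
        M *m pvec (P n) i.+1 (t n.+1) =
          G n i (t n.+1) - A *m pvec (P n) i (t n.+1),
      forall i, (i < m.-1./2)%N ->
        M *m pvec (P n) i.+1 (t n) = G n i (t n) - A *m pvec (P n) i (t n) &
      forall q : 'I_d -> {poly R}, (forall i, (size (q i) <= (s - m).+1)%N) ->
        \int[lebesgue_measure]_(x in `[t n, t n.+1])
            dotv (pvec (lhs_poly (P n)) 0 x) (pvec q 0 x)
          + (m == 0%N)%:R *
            dotv (M *m (pvec (P n) 0 (t n) - cell_left v0 P n)) (pvec q 0 (t n))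
        = \int[lebesgue_measure]_(x in `[t n, t n.+1])
            dotv (G n 0%N x) (pvec q 0 x)].

(** On a cell, interval-wise derivatives are the components of the jets
    ([pw_deriven_jet]), and the continuity of these up to both ends of the cell
    evaluates the one-sided limits.  Both directions are used: from the given
    solution to its pieces, and back for its derivatives. *)
Lemma VTD_cellVTD s m g v0 V P G :
  (forall n, (n < N)%N -> forall i, (size (P n i) <= s.+1)%N) ->
  (forall n, (n < N)%N -> {in cell t n, V =1 pvec (P n) 0}) ->
  (forall n, (n < N)%N -> {in cell t n, g =1 G n 0%N}) ->
  (forall n, (n < N)%N -> jet (t n) (t n.+1) m./2 (G n)) ->
  VTD M A N t s m g v0 V <-> cellVTD s m G v0 P.
Proof.
move=> szP VP gG jG.
have jP n l : jet (t n) (t n.+1) l (pvec (P n)) by exact: pvec_jet.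
have dV n l : (n < N)%N -> {in cell t n, pw_deriven N t l V =1 pvec (P n) l}.
  by move=> nN; exact: (pw_deriven_jet tS nN (jP n l) (VP n nN)).
have dg n l : (n < N)%N -> (l <= m./2)%N ->
    {in cell t n, pw_deriven N t l g =1 G n l}.
  by move=> nN; exact: (pw_deriven_jet tS nN (jG n nN) (gG n nN)).
have limVr n l : (n < N)%N ->
    lim (pw_deriven N t l V x @[x --> (t n)^'+]) = pvec (P n) l (t n).
  by move=> nN; apply: (jet_lim_right (tS nN) (jP n l) _ (dV n l nN)).
have limVl n l : (n < N)%N ->
    lim (pw_deriven N t l V x @[x --> (t n.+1)^'-]) = pvec (P n) l (t n.+1).
  by move=> nN; apply: (jet_lim_left (tS nN) (jP n l) _ (dV n l nN)).
have limgr n l : (n < N)%N -> (l < m./2)%N ->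
    lim (pw_deriven N t l g x @[x --> (t n)^'+]) = G n l (t n).
  move=> nN /ltnW lm.
  exact: (jet_lim_right (tS nN) (jG n nN) lm (dg n l nN lm)).
have limgl n l : (n < N)%N -> (l < m./2)%N ->
    lim (pw_deriven N t l g x @[x --> (t n.+1)^'-]) = G n l (t n.+1).
  move=> nN /ltnW lm.
  exact: (jet_lim_left (tS nN) (jG n nN) lm (dg n l nN lm)).
have leftE n : (n < N)%N -> left_value t v0 V n = cell_left v0 P n.
  by case: n => // n nN; apply: (limVl n 0%N); exact: ltnW.
have m12 i : (i < m.-1./2)%N -> (i < m./2)%N.
  by move=> /leq_trans; apply; apply: half_leq; exact: leq_pred.
have intL n (phi : R -> 'cV[R]_d) q :
    (n < N)%N -> {in cell t n, phi =1 pvec q 0} ->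
    \int[lebesgue_measure]_(x in cell t n)
      dotv (M *m pw_deriven N t 1 V x + A *m V x) (phi x) =
    \int[lebesgue_measure]_(x in `[t n, t n.+1])
      dotv (pvec (lhs_poly (P n)) 0 x) (pvec q 0 x).
  move=> nN phiq; apply: integral_oc_cc (tS nN) _ _.
    by apply: continuous_dotv; apply: (pvec_jet _ _ _ 0).2.
  by move=> x xn; rewrite lhs_polyE (dV n 1%N nN)// (VP n nN)// phiq.
have intR n (phi : R -> 'cV[R]_d) q :
    (n < N)%N -> {in cell t n, phi =1 pvec q 0} ->
    \int[lebesgue_measure]_(x in cell t n) dotv (g x) (phi x) =
    \int[lebesgue_measure]_(x in `[t n, t n.+1]) dotv (G n 0%N x) (pvec q 0 x).
  move=> nN phiq; apply: integral_oc_cc (tS nN) _ _.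
    by apply: continuous_dotv; [exact: (jG n nN).2 | apply: (pvec_jet _ _ _ 0).2].
  by move=> x xn; rewrite (gG n nN)// phiq.
have limphi n (phi : R -> 'cV[R]_d) q :
    (n < N)%N -> {in cell t n, phi =1 pvec q 0} ->
    lim (phi x @[x --> (t n)^'+]) = pvec q 0 (t n).
  move=> nN phiq.
  exact: (jet_lim_right (l := 0) (tS nN) (pvec_jet q _ _ 0) _ phiq).
have YV : Yspace N t s V.
  move=> n nN; exists (P n); split; first exact: szP.
  by move=> x xn; rewrite (VP n nN) ?inE.
split=> [[_ sol]|sol].
  move=> n nN; have [c1 c2 c3 c4] := sol n nN; split.
  - by move=> /c1; rewrite leftE// -(limVr n 0%N).
  - by move=> i im; rewrite -!limVl// -limgl//; exact: c2.
  - by move=> i im; rewrite -!limVr// -limgr ?m12//; exact: c3.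
  - move=> q szq; have := c4 (pvec q 0).
    rewrite (intL n _ q)// (intR n _ q)// (limphi n (pvec q 0) q)// leftE//.
    rewrite -(limVr n 0%N nN).
    by apply; exists q.
split=> // n nN; have [c1 c2 c3 c4] := sol n nN; split.
- by move=> /c1; rewrite leftE// -(limVr n 0%N).
- by move=> i im; rewrite !limVl// limgl//; exact: c2.
- by move=> i im; rewrite !limVr// limgr ?m12//; exact: c3.
- move=> phi [q [szq phiq]].
  have phiq' : {in cell t n, phi =1 pvec q 0} by move=> x; rewrite inE => /phiq.
  rewrite (intL n _ q)// (intR n _ q)// (limphi n phi q)// leftE//.
  by rewrite [lim (V x @[x --> _])](limVr n 0%N nN); exact: c4.
Qed.

Lemma dotvBl (u v w : 'cV[R]_d) : dotv (u - v) w = dotv u w - dotv v w.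
Proof.
rewrite /dotv -sumrB; apply: eq_bigr => i _; by rewrite !mxE mulrBl.
Qed.

(** One differentiation.  The collocation conditions shift by one order.  At a
    node, [M p' = Phi - A p] holds on the left, with [v1] as [p'] at the first
    node, and when [m >= 3] on the right as well; then [p'] inherits continuity
    from [p] and [Phi], as [M] is invertible.  In the variational equation the residual
    [w = M p' + A p - g] satisfies
      int (w', q) = (w, q)(right end) - (w, q)(left end) - int (w, q'),
    where the last integral vanishes by the equation tested with [q'], of one
    degree less, and [w] vanishes at the right end by collocation.  At the left end
    [w = 0] by collocation when [m >= 3]; when [m = 2] the new equation has a
    jump term, and [w] equals [M] times the jump of [p']. *)
Lemma cellVTD_deriv s m G v0 v1 (Phi : R -> 'cV[R]_d) P :
  M \in unitmx -> (2 <= m <= s)%N ->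
  (forall n, (n < N)%N -> jet (t n) (t n.+1) 1 (G n)) ->
  (forall n, (n < N)%N ->
    G n 0%N (t n) = Phi (t n) /\ G n 0%N (t n.+1) = Phi (t n.+1)) ->
  M *m v1 = Phi (t 0%N) - A *m v0 ->
  cellVTD s m G v0 P ->
  cellVTD s.-1 m.-2 (fun n l => G n l.+1) v1 (fun n i => (P n i)^`()).
Proof.
move=> Mu /andP[m2 ms] jG GPhi Mv1 sol.
have m_half : (0 < m./2)%N by rewrite half_gt0.
have leftE n : (n <= N)%N ->
    M *m cell_left v1 (fun n i => (P n i)^`()) n = Phi (t n) - A *m cell_left v0 P n.
  case: n => [//|n] nN /=; rewrite pvec_deriv.
  by have [_ /(_ 0%N m_half) -> _ _] := sol n nN; rewrite (GPhi n nN).2.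
move=> n nN; have [c1 c2 c3 c4] := sol n nN; have [GPhil GPhir] := GPhi n nN.
split.
- move=> m3; rewrite pvec_deriv; apply: (can_inj (mulKmx Mu)).
  rewrite leftE ?(ltnW nN)// -c1 ?(ltnW m2)// -GPhil.
  by apply: c3; case: (m) m3 => [|[|[|]]].
- move=> i im; rewrite !pvec_deriv; apply: c2.
  by case: (m) im => [|[|]].
- move=> i im; rewrite !pvec_deriv; apply: c3.
  by case: (m) im => [|[|[|]]].
- move=> q szq.
  have -> : pvec (lhs_poly (fun i => (P n i)^`())) 0 = pvec (lhs_poly (P n)) 1.
    apply/funext => x; by rewrite !lhs_polyE !pvec_deriv.
  rewrite (dotv_by_parts q (tS nN) (pvec_jet _ _ _ 1)).
  rewrite (dotv_by_parts q (tS nN) (jG n nN)).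
  have := c4 (fun i => (q i)^`()) _; rewrite gtn_eqF ?(ltnW m2)// mul0r addr0.
  rewrite !pvec_deriv => ->; last first.
    move=> i; apply: leq_trans (size_poly _ _) _; move: (szq i); lia.
  (* Both sides contain the same integral [I], so only end point terms matter. *)
  set I := Rintegral _ _ _.
  rewrite [in RHS]GPhil; apply/eqP; rewrite -subr_eq0; apply/eqP.
  have resR : pvec (lhs_poly (P n)) 0 (t n.+1) = G n 0%N (t n.+1).
    by rewrite lhs_polyE c2// subrK.
  rewrite resR lhs_polyE.
  have [m_eq2|m_ne2] := eqVneq m 2.
    rewrite m_eq2 /= mul1r mulmxBr leftE ?(ltnW nN)// -c1 ?(ltnW m2)//.
    by rewrite opprB addrA dotvBl; ring.
  have m3 : (2 < m)%N by rewrite ltn_neqAle eq_sym m_ne2.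
  rewrite (_ : m.-2 == 0%N = false); last by case: (m) m3 => [|[|[|]]].
  rewrite c3; last by case: (m) m3 => [|[|[|]]].
  by rewrite subrK GPhil (_ : false%:R = 0 :> R)// mul0r addr0 subrr.
Qed.

End CellwiseProblem.

(** * Existence of the Hermite interpolant *)
Section Hermite.
Variable R : realType.
Implicit Types (p q : {poly R}) (s : seq R).

Lemma derivn_mulXsubC (c : R) p l :
  (('X - c%:P) * p)^`(l) = ('X - c%:P) * p^`(l) + p^`(l.-1) *+ l.
Proof.
elim: l => [|l IHl]; first by rewrite !derivn0 addr0.
rewrite derivnS IHl derivD derivMn derivM derivB derivX derivC subr0 mul1r.
case: l {IHl} => [|l]; first by rewrite !mulr0n addr0 addrC !derivnS !derivn0.
by rewrite -!derivnS [l.+1.-1]/= [in RHS]mulrS [RHS]addrCA addrA.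
Qed.

(** Splitting off one factor [X - c] at a time by Leibniz' rule shows, together
    with [derivn_nodal_neq0], that the nodal polynomial vanishes at [a] exactly
    to the order given by the multiplicity of [a] among the nodes. *)
Lemma derivn_nodal s (a : R) l : (l < count_mem a s)%N ->
  (\prod_(c <- s) ('X - c%:P))^`(l).[a] = 0.
Proof.
elim: s l => [//|c s IHs] l /=; rewrite big_cons derivn_mulXsubC.
rewrite hornerD hornerM hornerMn hornerXsubC.
have [->|ca] := eqVneq c a => ls.
  case: l ls => [|l] ls; first by rewrite subrr mul0r mulr0n addr0.
  by rewrite subrr mul0r IHs ?mul0rn ?addr0.
rewrite add0n in ls.
by rewrite !IHs ?(leq_ltn_trans (leq_pred l) ls)// mulr0 mul0rn addr0.
Qed.

Lemma derivn_nodal_neq0 s (a : R) :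
  (\prod_(c <- s) ('X - c%:P))^`(count_mem a s).[a] != 0.
Proof.
elim: s => [|c s IHs] /=; first by rewrite big_nil /= hornerC oner_neq0.
rewrite big_cons derivn_mulXsubC hornerD hornerM hornerMn hornerXsubC.
have [->|ca] := eqVneq c a.
  by rewrite add1n subrr mul0r add0r mulrn_eq0.
rewrite add0n; case cnt: (count_mem a s) IHs => [|l] IHs.
  by rewrite mulr0n addr0 mulf_neq0// subr_eq0 eq_sym.
rewrite (derivn_nodal _ (l := l)) ?cnt// mul0rn addr0.
by rewrite mulf_neq0// subr_eq0 eq_sym.
Qed.

(** Newton's construction: adding a node [b] of current multiplicity [k] is paid
    for by a multiple of the nodal polynomial of the earlier nodes.  It disturbs
    none of the conditions already met, and its [k]-th derivative at [b] is
    nonzero, so the new condition can be met as well. *)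
Lemma confluent_interpolation s (y : nat -> R -> R) :
  exists p, (size p <= size s)%N /\
    forall a l, (l < count_mem a s)%N -> p^`(l).[a] = y l a.
Proof.
elim: s => [|b s [p [szp py]]]; first by exists 0; rewrite size_poly0.
pose Q := \prod_(c <- s) ('X - c%:P); pose k := count_mem b s.
pose c := (y k b - p^`(k).[b]) / Q^`(k).[b].
exists (p + c *: Q); split=> [|a l /=].
  rewrite (leq_trans (size_polyD _ _))// geq_max (leq_trans szp (leqnSn _))/=.
  by rewrite (leq_trans (size_scale_leq _ _))// size_prod_XsubC.
rewrite linearD linearZ /= hornerD hornerZ.
have [ls|sl] := ltnP l (count_mem a s) => lbs.
  by rewrite py// derivn_nodal// mulr0 addr0.
have [ba lE] : b = a /\ l = count_mem a s.
  move: lbs; have [->|_] := eqVneq b a.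
    by rewrite add1n ltnS => ls; split=> //; apply/eqP; rewrite eqn_leq ls.
  by rewrite add0n ltnNge sl.
rewrite lE -ba -/k /c mulfVK; last exact: derivn_nodal_neq0.
by rewrite addrC subrK.
Qed.

Lemma poly_rootsP p : p != 0 -> exists s,
  (size s < size p)%N /\ forall x, root p x -> x \in s.
Proof.
move=> p0; suff [s sP] : exists s, forall x, root p x -> x \in s.
  exists (undup [seq x <- s | root p x]); split; last first.
    by move=> x px; rewrite mem_undup mem_filter px sP.
  apply: max_poly_roots; rewrite ?undup_uniq//.
  by apply/allP => x; rewrite mem_undup mem_filter => /andP[].
have [n] := ubnP (size p); elim: n p p0 => // n IHn p p0; rewrite ltnS => szp.
have [[c /factor_theorem[q pE]]|noroot] := pselect (exists c, root p c).
  have q0 : q != 0 by apply: contra_neq p0 => q0; rewrite pE q0 mul0r.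
  have [|s sP] := IHn q q0.
    by move: szp; rewrite pE size_Mmonic ?monicXsubC// size_XsubC addn2.
  exists (c :: s) => x; rewrite pE rootM root_XsubC inE => /orP[/sP ->|->//].
  by rewrite orbT.
by exists [::] => x px; case: noroot; exists x.
Qed.

(** The end points carry [k + 1] conditions and the Jacobi polynomial has at most
    [r - k] roots, and [r + 1] coefficients are available. *)
Lemma hermiteP r k (g : R -> R) : (k <= r)%N -> is_hermite r k g (hermite r k g).
Proof.
move=> kr; apply: xgetPex.
pose J := jacobi R k.+1./2 k./2.+1 (r - k).
(* If no Jacobi polynomial exists, J is the default 1, which has no root. *)
have [J0 szJ] : J != 0 /\ (size J <= (r - k).+1)%N.
  rewrite /J /jacobi; case: xgetP => [P _ [Pm szP _]|_].
    by rewrite szP monic_neq0.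
  by rewrite oner_neq0 size_poly1.
have [s [szs sP]] := poly_rootsP J0.
(* The two end points and the roots may overlap here: surplus multiplicity only
   adds conditions, and the total stays at most r + 1. *)
pose nodes := nseq k.+1./2 (-1) ++ nseq k./2.+1 1 ++ s.
have [p [szp pP]] := confluent_interpolation nodes
  (fun l => deriven_on [set` `[(-1 : R), 1]] l g).
exists p; split.
- apply: (leq_trans szp); rewrite !size_cat !size_nseq.
  by have := uphalf_half k; have := odd_double_half k; rewrite uphalfE; lia.
- move=> l lk; apply: pP; rewrite !count_cat !count_nseq /= eqxx; lia.
- move=> l lk; apply: pP; rewrite !count_cat !count_nseq /= eqxx; lia.
- move=> x _ xJ; rewrite -[p]derivn0 pP// !count_cat.
  have : (0 < count_mem x s)%N by rewrite -has_count has_pred1; exact: sP.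
  by rewrite !addn_gt0 => ->; rewrite !orbT.
Qed.

End Hermite.

(** * Jets of the right-hand side *)
Section InterpolantJets.
Variable R : realType.
Implicit Types (a b x y : R).

Lemma deriv_on_coord d (J : set R) (g g' : R -> 'cV[R]_d) i :
  deriv_on J g g' -> deriv_on J (fun x => g x i 0) (fun x => g' x i 0).
Proof.
move=> dg x Jx.
have := @cvg_comp _ _ _ _ (fun v : 'cV[R]_d => v i 0) _ _ _ (dg x Jx)
  (@coord_continuous R d 1 i 0 (g' x)).
by apply: cvg_trans; apply: near_eq_cvg; near=> y; rewrite /diff_quot /= !mxE.
Unshelve. all: by end_near. Qed.

Lemma deriv_on_affine (J K : set R) (g g' : R -> R) (c e : R) : c != 0 ->
  (forall y, J y -> K (e + c * y)) -> deriv_on K g g' ->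
  deriv_on J (fun y => g (e + c * y)) (fun y => c * g' (e + c * y)).
Proof.
move=> c0 JK dg x Jx.
have rc : {for x, continuous (fun y => e + c * y)}.
  by apply: cvgD; [exact: cvg_cst | apply: cvgMr; exact: cvg_id].
have rinj y : y != x -> e + c * y != e + c * x.
  by apply: contra_neq => /addrI/(mulfI c0).
have dcomp := @cvg_comp _ _ _ (fun y => e + c * y) _ _ _ _
  (cvg_within_dnbhs rc rinj JK) (dg _ (JK _ Jx)).
have dM : c * diff_quot g (e + c * x) (e + c * y) @[y --> within J x^'] -->
    c * g' (e + c * x).
  by apply: cvgM dcomp; exact: cvg_cst.
apply: cvg_trans dM; apply: near_eq_cvg; near=> y.
rewrite /diff_quot /= /GRing.scale /= mulrA; congr (_ * _).
have -> : e + c * y - (e + c * x) = c * (y - x) by ring.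
by rewrite invfM mulrA mulfV// mul1r.
Unshelve. all: by end_near. Qed.

Lemma deriven_on_from_ref a b p (F : nat -> R -> R) : a < b ->
  (forall l, (l < p)%N -> deriv_on `[a, b] (F l) (F l.+1)) ->
  forall l, (l <= p)%N -> {in [set` `[(-1 : R), 1]],
    deriven_on `[(-1 : R), 1] l (fun y => F 0%N (from_ref a b y)) =1
    fun y => ((b - a) / 2) ^+ l * F l (from_ref a b y)}.
Proof.
move=> ab dF; elim=> [|l IHl] lp x xI; first by rewrite mul1r.
have c0 : (b - a) / 2 != 0.
  by rewrite mulf_neq0// ?subr_eq0 ?gt_eqF// invr_eq0 pnatr_eq0.
have JK y : [set` `[(-1 : R), 1]] y -> [set` `[a, b]] (from_ref a b y).
  by rewrite /= !in_itv /= /from_ref => /andP[y1 y2]; apply/andP; split; nra.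
have dl := deriv_on_affine c0 JK (dF l lp).
have dcl : deriv_on `[(-1 : R), 1]
    (fun y => ((b - a) / 2) ^+ l * F l (from_ref a b y))
    (fun y => ((b - a) / 2) ^+ l.+1 * F l.+1 (from_ref a b y)).
  move=> y Jy; rewrite exprSr -mulrA.
  move: (dl y Jy) => /(cvgM (cvg_cst (((b - a) / 2) ^+ l))).
  apply: cvg_trans; apply: near_eq_cvg; near=> z.
  by rewrite /diff_quot /= /GRing.scale /= mulrCA mulrBr.
move: (xI); rewrite inE => xJ.
apply: (deriv_onE (a := -1) (b := 1) _ _ _ xJ _ (IHl (ltnW lp)) dcl) => //.
exact: subset_itv_oo_cc.
Unshelve. all: by end_near. Qed.

Definition to_ref_poly a b : {poly R} :=
  (2 / (b - a)) *: 'X - ((a + b) / (b - a))%:P.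

Lemma to_ref_polyE a b x : (to_ref_poly a b).[x] = to_ref a b x.
Proof. by rewrite !hornerE /to_ref; ring. Qed.

Lemma derivn_comp_to_ref a b (p : {poly R}) l :
  (p \Po to_ref_poly a b)^`(l) =
  (2 / (b - a)) ^+ l *: (p^`(l) \Po to_ref_poly a b).
Proof.
elim: l => [|l IHl]; first by rewrite scale1r.
rewrite derivnS IHl derivZ deriv_comp -derivnS exprSr -scalerA.
congr (_ *: _).
by rewrite /to_ref_poly derivB derivZ derivX derivC subr0 -scalerAr mulr1.
Qed.

(** Scaling the [l]-th derivative to the reference interval multiplies it by
    [((b - a) / 2) ^+ l], and scaling the interpolant back multiplies it by the
    inverse, so matching derivatives at -1 and 1 become matching derivatives at
    [a] and [b]. *)
Lemma interp_endpoints d a b r k (F : nat -> R -> 'cV[R]_d) :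
  a < b -> (k <= r)%N -> jet a b k./2 F ->
  let p i := hermite r k (fun y => F 0%N (from_ref a b y) i 0) \Po to_ref_poly a b in
  forall l, (l < k./2)%N -> pvec p l a = F l a /\ pvec p l b = F l b.
Proof.
move=> ab kr [dF _] p l lk.
have ab0 : b - a != 0 by rewrite subr_eq0 gt_eqF.
have key (e : R) i : [set` `[(-1 : R), 1]] e ->
    (hermite r k (fun y => F 0%N (from_ref a b y) i 0))^`(l).[e] =
      deriven_on `[(-1 : R), 1] l (fun y => F 0%N (from_ref a b y) i 0) e ->
    ((p i)^`(l)).[from_ref a b e] = F l (from_ref a b e) i 0.
  move=> eI he; rewrite derivn_comp_to_ref hornerZ horner_comp to_ref_polyE.
  have -> : to_ref a b (from_ref a b e) = e by rewrite /to_ref /from_ref; field.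
  rewrite he (deriven_on_from_ref (F := fun l x => F l x i 0) (p := k./2) ab)//.
  - rewrite mulrA -exprMn (_ : 2 / (b - a) * ((b - a) / 2) = 1) ?expr1n ?mul1r//.
    by field.
  - by move=> m mk; apply: deriv_on_coord; exact: dF.
  - exact: ltnW.
  - by rewrite inE.
have lk1 : (l < k.+1./2)%N by rewrite (leq_trans lk)// half_leq.
have [aE bE] : from_ref a b (-1) = a /\ from_ref a b 1 = b.
  by split; rewrite /from_ref; field.
split; apply/colP => i; rewrite mxE.
  have [_ hl _ _] := hermiteP (fun y => F 0%N (from_ref a b y) i 0) kr.
  have := key (-1) i _ (hl l lk1); rewrite aE; apply.
  by rewrite /= in_itv /=; apply/andP; split; lra.
have [_ _ hr _] := hermiteP (fun y => F 0%N (from_ref a b y) i 0) kr.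
have := key 1 i _ (hr l (ltnW lk)); rewrite bE; apply.
by rewrite /= in_itv /=; apply/andP; split; lra.
Qed.

End InterpolantJets.

(** What the differentiation step needs from either choice of right-hand side:
    at both ends of every cell it agrees with [f] up to derivatives of order
    [k./2 - 1].  Its derivatives of these orders are therefore continuous across
    the nodes, and at [t0] they are those in the recursion for the initial
    values. *)
Lemma right_hand_side_jets (R : realType) (d : nat) (t0 T : R)
    (N : nat) (t : nat -> R) (r k : nat) (f : R -> 'cV[R]_d)
    (Iop : (R -> 'cV[R]_d) -> (R -> 'cV[R]_d)) :
  is_mesh N t t0 T -> (k <= r)%N -> C_on [set` `[t0, t0 + T]] k./2 f ->
  Iop = id \/ Iop = interp N t r k ->
  exists G : nat -> nat -> R -> 'cV[R]_d, forall n, (n < N)%N ->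
  [/\ {in cell t n, Iop f =1 G n 0%N},
      jet (t n) (t n.+1) k./2 (G n) &
      forall l, (l < k./2)%N ->
        G n l (t n) = deriven_on [set` `[t0, t0 + T]] l f (t n) /\
        G n l (t n.+1) = deriven_on [set` `[t0, t0 + T]] l f (t n.+1)].
Proof.
move=> [tz tN tS] kr /C_on_jet jf Iop_choice.
have jfn n : (n < N)%N ->
    jet (t n) (t n.+1) k./2 (fun l => deriven_on `[t0, t0 + T] l f).
  move=> nN; apply: jet_sub jf.
  - by rewrite -tz (mesh_le tS)//= ltnW.
  - by rewrite -tN (mesh_le tS)// nN leqnn.
case: Iop_choice => ->; first by
  exists (fun n l => deriven_on `[t0, t0 + T] l f) => n nN; split => //; exact: jfn.
exists (fun n => pvec (fun i => hermite r k
  (fun y => f (from_ref (t n) (t n.+1) y) i 0) \Po to_ref_poly (t n) (t n.+1))).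
move=> n nN; split; last exact: interp_endpoints (tS _ nN) kr (jfn n nN).
- move=> x xn; rewrite /interp (piecewise_cell tS _ nN xn).
  by apply/colP => i; rewrite !mxE horner_comp to_ref_polyE.
- exact: pvec_jet.
Qed.

Unset Implicit Arguments.

Theorem corollary6p2 (R : realType) (d : nat) (t0 T : R) (T_gt0 : 0 < T)
    (M A : 'M[R]_d) (M_reg : M \in unitmx)
    (N : nat) (t : nat -> R) (t_mesh : is_mesh N t t0 T)
    (r k : nat) (k_le_r : (k <= r)%N)
    (f : R -> 'cV[R]_d) (f_smooth : C_on [set` `[t0, t0 + T]] k./2 f)
    (u0 : 'cV[R]_d)
    (Iop : (R -> 'cV[R]_d) -> (R -> 'cV[R]_d))
    (Iop_choice : Iop = id \/ Iop = interp N t r k)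
    (U : R -> 'cV[R]_d) (U_sol : VTD M A N t r k (Iop f) u0 U) :
  forall j : nat, (j <= k./2)%N ->
    VTD M A N t (r - j) (k - j.*2) (pw_deriven N t j (Iop f))
      (uderiv M A f u0 t0 T j) (pw_deriven N t j U).
Proof.
have [tz _ tS] := t_mesh.
have [G GP] := right_hand_side_jets t_mesh k_le_r f_smooth Iop_choice.
have [P PP] : exists P : nat -> 'I_d -> {poly R}, forall n, (n < N)%N ->
    (forall i, (size (P n i) <= r.+1)%N) /\ {in cell t n, U =1 pvec (P n) 0}.
  have /choice[P PP] : forall n, exists p : 'I_d -> {poly R}, (n < N)%N ->
      (forall i, (size (p i) <= r.+1)%N) /\ {in cell t n, U =1 pvec p 0}.
    move=> n; case: (ltnP n N) => [nN|_]; last by exists (fun=> 0).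
    have [p [szp Up]] := U_sol.1 n nN; exists p => _; split=> // x.
    by rewrite inE => /Up.
  by exists P.
have cell_sol j : (j <= k./2)%N -> cellVTD M A N t (r - j) (k - j.*2)
    (fun n l => G n (l + j)%N) (uderiv M A f u0 t0 T j)
    (fun n i => (P n i)^`(j)).
  elim: j => [_|j IHj jk].
    rewrite subn0 double0 subn0.
    have jG n : (n < N)%N -> jet (t n) (t n.+1) k./2 (fun l => G n (l + 0)%N).
      move=> nN; have [_ jG _] := GP n nN.
      by have := jet_shift (leq0n _) jG; rewrite subn0.
    apply: (VTD_cellVTD M A tS u0 _ _ _ jG).1 U_sol.
    - by move=> n nN; exact: (PP n nN).1.
    - by move=> n nN; exact: (PP n nN).2.
    - by move=> n nN; have [] := GP n nN.
  have -> : (r - j.+1 = (r - j).-1)%N by lia.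
  have -> : (k - j.+1.*2 = (k - j.*2).-2)%N by lia.
  rewrite (_ : (fun n l => G n (l + j.+1)%N) =
      fun n l => G n (l.+1 + j)%N); last first.
    by apply/funext => n; apply/funext => l; rewrite addSnnS.
  apply: (cellVTD_deriv (Phi := deriven_on `[t0, t0 + T] j f) tS M_reg _ _ _ _
    (IHj (ltnW jk))).
  - by apply/andP; split; lia.
  - move=> n nN; have [_ jG _] := GP n nN.
    have [dG cG] := jet_shift (ltnW jk) jG.
    by split=> l lp; [apply: dG | apply: cG]; lia.
  - by move=> n nN; have [_ _ GF] := GP n nN; exact: GF.
  - by rewrite tz /= mulKVmx.
move=> j jk; apply: (VTD_cellVTD M A tS _ _ _ _ _).2 (cell_sol j jk).
- move=> n nN i; rewrite (leq_trans (size_derivn _ _))//.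
  by have := (PP n nN).1 i; lia.
- move=> n nN; exact: (pw_deriven_jet tS nN (pvec_jet _ _ _ j) (PP n nN).2).
- move=> n nN; have [gG jG _] := GP n nN.
  exact: (pw_deriven_jet tS nN jG gG).
- move=> n nN; have [_ jG _] := GP n nN.
  have -> : ((k - j.*2)./2 = k./2 - j)%N by lia.
  exact: jet_shift.
Qed.
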